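(* Let $\mathbb{F}$ be a field with involution $\overline{\,\cdot\,}$, let $m,n\ge 1$, let $x,y\in\mathbb{F}^m$ and $z,w\in\mathbb{F}^n$ be column vectors with all entries nonzero, let $a,b\in\mathbb{F}\setminus\{0\}$, and let $$M=\left[\begin{array}{cc|cc}0&x^T&a&0\\ y&0&0&0\\ \hline b&0&0&z^T\\ 0&0&w&0\end{array}\right]$$ (a square matrix of order $m+n+2$). Assume $x^Ty\neq 0$, $z^Tw=0$ and $\zeta:=x^Ty+ab\neq 0$, and that $M$ is Moore–Penrose invertible and core EP invertible (equivalently, the scalars $s=x^*x$, $u=y^*y$, $t=z^*z$, $v=w^*w$, $h=b\overline{b}+y^*y$, $\beta=\zeta\overline{\zeta}+b\overline{b}\,w^*w$ are all nonzero). Then the MPCEP inverse of $M$ is $$M^{\dagger,\mathrm{cEP}}=\left[\begin{array}{cc|cc}0&h^{-1}y^*&\overline{b}h^{-1}&0\\ (s\beta)^{-1}\overline{\zeta}(x^Ty)\overline{x}&0&0&(s\beta)^{-1}\overline{b}(x^Ty)\overline{x}w^*\\ \hline \beta^{-1}\overline{\zeta}b&0&0&\beta^{-1}b\overline{b}w^*\\ 0&0&0&0\end{array}\right].$$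
   Context: For a matrix $A=[a_{ij}]$ over a field $\mathbb{F}$ with involution $\overline{\,\cdot\,}$ (a field automorphism with $\overline{\overline{c}}=c$), $\overline{A}=[\overline{a_{ij}}]$ and $A^*=\overline{A}^{\,T}$. All $4\times4$ block matrices have rows and columns partitioned with sizes $1,m,1,n$; each $0$ is a zero block of the appropriate size. Matrices $M$ of the displayed form are the matrices whose associated digraph is a double star digraph, in canonical form. The Moore–Penrose inverse $A^\dagger$ is the unique $X$ (if it exists) with $AXA=A$, $XAX=X$, $(AX)^*=AX$, $(XA)^*=XA$. A square matrix $A$ is core EP invertible if there is $X$ with $XA^{k+1}=A^k$ for some nonnegative integer $k$, $AX^2=X$, $(AX)^*=AX$; such $X$ is unique, called the core EP inverse and denoted $A^{\mathrm{cEP}}$. When $A^\dagger$ and $A^{\mathrm{cEP}}$ exist, the MPCEP (Moore–Penrose–core EP) inverse of $A$ is the unique $X$ with $XAX=X$, $AX=AA^{\mathrm{cEP}}$, $XA=A^\dagger AA^{\mathrm{cEP}}A$; explicitly $A^{\dagger,\mathrm{cEP}}=A^\dagger AA^{\mathrm{cEP}}$. *)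

(* Defs.v *)
From HB Require Import structures.
From mathcomp Require Import all_boot all_order all_algebra.

Set Implicit Arguments.
Unset Strict Implicit.
Unset Printing Implicit Defensive.

Import GRing.Theory.
Export GRing.Theory.
#[export] Set Implicit Arguments.
#[export] Unset Strict Implicit.
#[export] Unset Printing Implicit Defensive.

Local Open Scope ring_scope.
Local Open Scope sesquilinear_scope.

(* The field with involution is [F : fieldType] together with
   [theta : involutive_rmorphism F]; [A ^t theta] is the conjugate transpose. *)

Section GeneralizedInverses.
Variables (F : fieldType) (theta : involutive_rmorphism F).

Definition is_mp_inverse p q (A : 'M[F]_(p, q)) (X : 'M[F]_(q, p)) : Prop :=
  [/\ A *m X *m A = A, X *m A *m X = X,
      (A *m X) ^t theta = A *m X & (X *m A) ^t theta = X *m A].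

Definition is_cep_inverse p (A X : 'M[F]_p) : Prop :=
  [/\ exists k : nat, X *m A ^+ k.+1 = A ^+ k,
      A *m (X *m X) = X & (A *m X) ^t theta = A *m X].

Definition is_mpcep_inverse p (A X : 'M[F]_p) : Prop :=
  exists P C : 'M[F]_p,
    [/\ is_mp_inverse A P, is_cep_inverse A C
      & [/\ X *m A *m X = X, A *m X = A *m C & X *m A = P *m A *m C *m A]].

Definition mp_invertible p q (A : 'M[F]_(p, q)) : Prop :=
  exists X, is_mp_inverse A X.

Definition cep_invertible p (A : 'M[F]_p) : Prop :=
  exists X, is_cep_inverse A X.

Lemma ctrmx_mul p q r (A : 'M[F]_(p, q)) (B : 'M[F]_(q, r)) :
  (A *m B) ^t theta = B ^t theta *m A ^t theta.
Proof. by rewrite trmx_mul map_mxM. Qed.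

Lemma mp_inverse_unique p q (A : 'M[F]_(p, q)) X Y :
  is_mp_inverse A X -> is_mp_inverse A Y -> X = Y.
Proof.
move=> [X1 X2 X3 X4] [Y1 Y2 Y3 Y4].
have AE : A *m X = A *m Y.
  by rewrite -[in LHS]Y1 -mulmxA -X3 -[in LHS]Y3 -ctrmx_mul mulmxA X1 Y3.
have EA : X *m A = Y *m A.
  by rewrite -[in LHS]Y1 2!mulmxA -mulmxA -X4 -Y4 -ctrmx_mul -mulmxA (mulmxA A) X1 Y4.
by rewrite -X2 EA -mulmxA AE mulmxA Y2.
Qed.

Section CoreEP.
Variables (p : nat) (A : 'M[F]_p).

Lemma cep_inverse_powers X :
  A *m (X *m X) = X -> forall j, A ^+ j *m X ^+ j.+1 = X.
Proof.
move=> AXX; elim=> [|j IH]; first by rewrite expr0 expr1 mul1mx.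
rewrite exprSr exprS exprS -mulmxE -mulmxA (mulmxA X X) (mulmxA A) AXX.
by rewrite mulmxE -exprS -mulmxE IH.
Qed.

Lemma cep_inverse_absorb X Y :
  is_cep_inverse A X -> is_cep_inverse A Y -> X *m A *m Y = Y.
Proof.
move=> [[k Xk] _ _] [_ Y2 _].
rewrite -[in LHS](cep_inverse_powers Y2 k) -(mulmxA X) (mulmxA A) (mulmxA X).
by rewrite -[A *m A ^+ k]exprS Xk cep_inverse_powers.
Qed.

Lemma cep_inverse_unique X Y :
  is_cep_inverse A X -> is_cep_inverse A Y -> X = Y.
Proof.
move=> hX hY; have [_ X2 X3] := hX; have [_ Y2 Y3] := hY.
have EXY : A *m X *m (A *m Y) = A *m Y.
  by rewrite -mulmxA (mulmxA X) cep_inverse_absorb.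
have EYX : A *m Y *m (A *m X) = A *m X.
  by rewrite -mulmxA (mulmxA Y) cep_inverse_absorb.
have E : A *m X = A *m Y by rewrite -X3 -EYX ctrmx_mul X3 Y3 EXY.
rewrite -(cep_inverse_absorb hX hX) -mulmxA E mulmxA.
exact: cep_inverse_absorb.
Qed.

Lemma mpcep_inverseE P C X :
  is_mp_inverse A P -> is_cep_inverse A C ->
  is_mpcep_inverse A X <-> X = P *m A *m C.
Proof.
move=> hP hC; have [P1 _ _ _] := hP; have CC := cep_inverse_absorb hC hC.
split=> [[P' [C' [hP' hC' [X1 X2 X3]]]]|->].
  rewrite (mp_inverse_unique hP hP') (cep_inverse_unique hC hC').
  by rewrite -X1 X3 -[_ *m A *m X]mulmxA X2 -!mulmxA (mulmxA C')
             cep_inverse_absorb.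
have APAC : A *m (P *m A *m C) = A *m C by rewrite !mulmxA P1.
exists P, C; split=> //; split=> //.
by rewrite -(mulmxA _ A) APAC -!mulmxA (mulmxA C) CC.
Qed.

End CoreEP.
End GeneralizedInverses.

Definition double_star_mx (F : fieldType) m n (x y : 'cV[F]_m)
    (z w : 'cV[F]_n) (a b : F) : 'M[F]_((1 + m) + (1 + n)) :=
  block_mx (block_mx 0    x^T
                     y    0)     (block_mx a%:M 0
                                           0    0)
           (block_mx b%:M 0
                     0    0)     (block_mx 0    z^T
                                           w    0).

(* Main.v *)
Require Import Defs.
From HB Require Import structures.
From mathcomp Require Import all_boot all_order all_algebra.
From mathcomp Require Import ring.

Local Open Scope ring_scope.
Local Open Scope sesquilinear_scope.

(** Number the vertices of the double star p (first centre), q (its leaves),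
    r (second centre) and o (leaves of r).  Every arc joins {p, o} to {q, r}, so
    [M] exchanges the two corresponding coordinate subspaces and splits into
    two rank-two maps between them.

    The Moore-Penrose side only sees row and column spaces.  An orthogonal
    basis of the column space of [M] is e_p, (0,y,0,0), e_r, (0,0,0,w), and one
    of the column space of [M]^* is e_p, (0,conj(x),0,0), e_r, (0,0,0,conj(z)).  If these eight vectors have
    nonzero square norms 1, u, 1, v and 1, s, 1, t, the orthogonal projections
    onto both spaces are explicit ([col_proj], [row_proj]), and [double_star_mp]
    is the solution of M X = col_proj, X M = row_proj.  Conversely an isotropic
    vector of the column space that is orthogonal to all columns of [M] obstructs
    Moore-Penrose invertibility ([mp_ctrmx_cancel]); this forces u and v to be
    nonzero, and the same argument for the transpose, which is again a double
    star with the roles of (x, z) and (y, w) exchanged, gives s and t.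

    The core EP side only sees the stable image of [M].  Put f = (0, y, b, 0) and
    g = (zeta, 0, 0, b w).  Then M f = g, and z^T w = 0 makes M g = zeta f, while
    M^3 has column space inside the span of f and g ([double_star_cube]).  So [M]
    acts invertibly on that plane and its remaining part is nilpotent.  Since f
    and g are supported on complementary sets of vertices they are orthogonal,
    with square norms h and beta; M M^cEP is the orthogonal projection onto the
    plane, it exists exactly when h and beta are nonzero ([cep_cycle_neq0],
    [cycle_cepP]), and M^cEP is f -> zeta^-1 g, g -> f composed with it.

    The MPCEP inverse is row_proj * M^cEP, that is, M^cEP with g and f on the
    left replaced by row_proj g = (zeta, 0, 0, 0) and
    row_proj f = (0, s^-1 (x^T y) conj(x), b, 0), which is the stated matrix. *)

(** * Conjugate transposes and Moore-Penrose inverses *)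

Section ConjugateTranspose.
Variables (F : fieldType) (theta : involutive_rmorphism F).

Lemma ctrmxK p q (A : 'M[F]_(p, q)) : (A ^t theta) ^t theta = A.
Proof. by apply/matrixP => i j; rewrite !mxE rmorphK. Qed.

Lemma ctrmx_eq0 p q (A : 'M[F]_(p, q)) : (A ^t theta == 0) = (A == 0).
Proof.
apply/eqP/eqP => [A0|->]; last by rewrite trmx0 map_mx0.
by rewrite -[A]ctrmxK A0 trmx0 map_mx0.
Qed.

Lemma normsq_herm p (v : 'cV[F]_p) :
  theta ((v ^t theta *m v) 0 0) = (v ^t theta *m v) 0 0.
Proof.
have /matrixP/(_ 0 0) := ctrmx_mul theta (v ^t theta) v.
by rewrite ctrmxK !mxE.
Qed.

Lemma ctr_outer p q (A : 'M[F]_(p, q)) (c : F) :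
  theta c = c -> (c *: (A *m A ^t theta)) ^t theta = c *: (A *m A ^t theta).
Proof. by move=> hc; rewrite linearZ map_mxZ ctrmx_mul ctrmxK; congr (_ *: _). Qed.

Lemma mp_inverse_of_projections p q (A : 'M[F]_(p, q)) X S T :
  A *m X = S -> X *m A = T -> S *m A = A -> T *m X = X ->
  S ^t theta = S -> T ^t theta = T -> is_mp_inverse theta A X.
Proof. by move=> AX XA SA TX hS hT; split; rewrite ?AX ?XA. Qed.

(** Once [A] is Moore-Penrose invertible, its column space meets its own
    orthogonal complement only in 0, because A B = (A X)^* A B = X^* (A^* A B). *)
Lemma mp_ctrmx_cancel p q r (A : 'M[F]_(p, q)) (B : 'M[F]_(q, r)) :
  mp_invertible theta A -> A ^t theta *m (A *m B) = 0 -> A *m B = 0.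
Proof.
move=> [X [AXA _ AX _]] AAB.
by rewrite -{1}AXA -AX ctrmx_mul -!mulmxA AAB mulmx0.
Qed.

Lemma mp_invertible_tr p q (A : 'M[F]_(p, q)) :
  mp_invertible theta A -> mp_invertible theta A^T.
Proof.
move=> [X [X1 X2 X3 X4]]; exists X^T; split; rewrite -!trmx_mul.
- by rewrite mulmxA X1.
- by rewrite mulmxA X2.
- by rewrite -map_trmx X4.
- by rewrite -map_trmx X3.
Qed.

(** * Core EP inverse of a matrix whose stable image is a plane swapped by it *)

Section CoreCycle.
Variables (p : nat) (A : 'M[F]_p) (f g : 'cV[F]_p) (c : F).
Hypotheses (c0 : c != 0) (Af : A *m f = g) (Ag : A *m g = c *: f).
Hypothesis fg0 : f ^t theta *m g = 0.
Variables (k : nat) (phi psi : 'rV[F]_p).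
Hypothesis Ak : A ^+ k = f *m phi + g *m psi.

Let h := (f ^t theta *m f) 0 0.
Let beta := (g ^t theta *m g) 0 0.

Lemma cycle_orth : g ^t theta *m f = 0.
Proof. by rewrite -[f]ctrmxK -ctrmx_mul fg0 trmx0 map_mx0. Qed.

(** Both f and g are eigenvectors of the square of [A] for the scalar [c] <> 0, hence
    lie in the image of every power of [A], where A C acts as the identity. *)
Lemma cycle_fixed C : is_cep_inverse theta A C ->
  A *m C *m f = f /\ A *m C *m g = g.
Proof.
move=> [[j Cj] _ _].
have AAf : A *m (A *m f) = c *: f by rewrite Af.
have AAg : A *m (A *m g) = c *: g by rewrite Ag -scalemxAr Af.
have cj0 i : c ^+ i != 0 by rewrite expf_neq0.
have pow (v : 'cV[F]_p) i : A *m (A *m v) = c *: v -> A ^+ (i.*2) *m v = c ^+ i *: v.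
  move=> Av; elim: i => [|i IH]; first by rewrite !expr0 mul1mx scale1r.
  rewrite doubleS exprSr exprSr -!mulmxE -!mulmxA Av -scalemxAr IH scalerA.
  by rewrite exprS.
have fix_pow i : (j < i)%N -> A *m C *m A ^+ i = A ^+ i.
  move=> ji; rewrite -(subnKC ji) exprD -mulmxE mulmxA -(mulmxA A) Cj.
  by rewrite exprS mulmxE.
have fixv (v : 'cV[F]_p) : A *m (A *m v) = c *: v -> A *m C *m v = v.
  (* A^(2j+2) v = c^(j+1) v, and 2j + 2 > j suffices for A C to fix A^(2j+2). *)
  move=> Av; apply: (scalerI (cj0 j.+1)).
  rewrite scalemxAr -(pow _ _ Av) mulmxA fix_pow //.
  by rewrite -addnn addSn ltnS leq_addr.
by split; apply: fixv.
Qed.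

(** A C = A^k (A C^(k+1)) inherits the column space of A^k. *)
Lemma cycle_projection C : is_cep_inverse theta A C ->
  exists phi' psi' : 'rV[F]_p, A *m C = f *m phi' + g *m psi'.
Proof.
move=> [_ ACC _]; exists (phi *m (A *m C ^+ k.+1)), (psi *m (A *m C ^+ k.+1)).
rewrite !mulmxA -!mulmxDl -Ak -[in LHS](cep_inverse_powers ACC k) mulmxA.
by congr (_ *m _); rewrite mulmxE -exprS exprSr.
Qed.

(** If f were isotropic it would be orthogonal to the span of f and g, which
    contains the image of the hermitian matrix A C; but then
    f^* = (A C f)^* = f^* A C = 0.  The same goes for g. *)
Lemma cep_cycle_neq0 :
  f != 0 -> g != 0 -> cep_invertible theta A -> h != 0 /\ beta != 0.
Proof.
move=> f0 g0 [C hC]; have [fixf fixg] := cycle_fixed hC.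
have [phi' [psi' ACE]] := cycle_projection hC; have [_ _ ACh] := hC.
have fix_herm (v : 'cV[F]_p) : A *m C *m v = v -> v ^t theta = v ^t theta *m (A *m C).
  by move=> {1}<-; rewrite ctrmx_mul ACh.
split.
- apply: contraNneq f0 => h0; rewrite -ctrmx_eq0 (fix_herm _ fixf) ACE.
  by rewrite mulmxDr !mulmxA fg0 [_ *m f]mx11_scalar -/h h0 mul_scalar_mx scale0r
             mul0mx addr0.
- apply: contraNneq g0 => b0; rewrite -ctrmx_eq0 (fix_herm _ fixg) ACE.
  by rewrite mulmxDr !mulmxA cycle_orth [_ *m g]mx11_scalar -/beta b0 mul_scalar_mx
             scale0r mul0mx addr0.
Qed.

(** The inverse f -> c^-1 g, g -> f of [A] on the span of f and g, preceded by the
    orthogonal projection onto that span. *)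
Definition cycle_cep : 'M[F]_p :=
  (c * h)^-1 *: (g *m f ^t theta) + beta^-1 *: (f *m g ^t theta).

Lemma cycle_cepP : h != 0 -> beta != 0 -> is_cep_inverse theta A cycle_cep.
Proof.
move=> h0 b0.
have Cf : cycle_cep *m f = c^-1 *: g.
  rewrite mulmxDl -!scalemxAl -!mulmxA cycle_orth mulmx0 scaler0 addr0.
  rewrite [_ *m f]mx11_scalar -/h mul_mx_scalar scalerA; congr (_ *: _).
  by field; rewrite h0 c0.
have Cg : cycle_cep *m g = f.
  rewrite mulmxDl -!scalemxAl -!mulmxA fg0 mulmx0 scaler0 add0r.
  by rewrite [_ *m g]mx11_scalar -/beta mul_mx_scalar scalerA mulVf ?scale1r.
have AC : A *m cycle_cep =
    h^-1 *: (f *m f ^t theta) + beta^-1 *: (g *m g ^t theta).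
  rewrite mulmxDr -!scalemxAr !mulmxA Af Ag -scalemxAl scalerA.
  by congr (_ *: _ + _); field; rewrite h0 c0.
split.
- exists k; rewrite exprSr -mulmxE Ak mulmxDl -!mulmxA.
  have -> : f *m (phi *m A) + g *m (psi *m A) = A *m (f *m phi + g *m psi).
    by rewrite -Ak mulmxE -exprS exprSr -mulmxE Ak mulmxDl -!mulmxA.
  rewrite mulmxDr !mulmxA mulmxDr !mulmxA -(mulmxA cycle_cep A f) -(mulmxA cycle_cep A g)
    Af Ag Cg.
  by rewrite -scalemxAr Cf scalerA mulfV ?scale1r.
- rewrite mulmxA {2}/cycle_cep mulmxDr -!scalemxAr !(mulmxA (_ *m _)).
  by rewrite -(mulmxA A _ g) -(mulmxA A _ f) Cg Cf Af -scalemxAr Ag scalerA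
             mulVf ?scale1r.
- rewrite AC linearD map_mxD !linearZ /= !map_mxZ !ctrmx_mul !ctrmxK.
  by rewrite !fmorphV; congr (_^-1 *: _ + _^-1 *: _); apply: normsq_herm.
Qed.

End CoreCycle.

End ConjugateTranspose.

(** * Block computations with double star matrices *)

Definition mul_blockE := (mulmx_block, mul_block_col, mul_row_col, mul_col_row,
  mul_row_block, mul_col_mx, mul_mx_row, add_block_mx, add_col_mx).
Definition ctr_blockE := (tr_block_mx, map_block_mx, tr_col_mx, map_row_mx,
  tr_row_mx, map_col_mx, tr_scalar_mx, map_scalar_mx).
Definition scalar_mxE := (mul_scalar_mx, mul_mx_scalar, scale_scalar_mx).
Definition zero_mxE := (mul0mx, mulmx0, add0r, addr0, scaler0, trmx0, map_mx0).

Lemma scalar_mx11_eq0 (R : fieldType) (c : R) : (c%:M == 0 :> 'M_1) = (c == 0).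
Proof.
apply/eqP/eqP => [/matrixP/(_ 0 0)|->]; last exact: raddf0.
by rewrite !mxE eqxx.
Qed.

Lemma tr_double_star (F : fieldType) m n (x y : 'cV[F]_m) (z w : 'cV[F]_n) (a b : F) :
  (double_star_mx x y z w a b)^T = double_star_mx y x w z b a.
Proof. by rewrite !(tr_block_mx, tr_scalar_mx, trmx0) !trmxK. Qed.

Lemma left_inverse_col (F : fieldType) n (z : 'cV[F]_n) :
  z != 0 -> exists c : 'cV[F]_n, z^T *m c = 1%:M.
Proof.
case/cV0Pn => i zi; exists ((z i 0)^-1 *: delta_mx i 0).
by apply/matrixP => j k; rewrite !ord1 -scalemxAr mxE -colE !mxE mulVf.
Qed.

Section DoubleStar.
Variables (F : fieldType) (theta : involutive_rmorphism F) (m n : nat).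
Variables (x y : 'cV[F]_m) (z w : 'cV[F]_n) (a b : F).

Let M := double_star_mx x y z w a b.
Let xy := (x^T *m y) 0 0.
Let zeta := xy + a * b.
Let s := (x ^t theta *m x) 0 0.
Let u := (y ^t theta *m y) 0 0.
Let t := (z ^t theta *m z) 0 0.
Let v := (w ^t theta *m w) 0 0.
Let h := b * theta b + u.
Let beta := zeta * theta zeta + b * theta b * v.

Lemma xyE : x^T *m y = xy%:M. Proof. exact: mx11_scalar. Qed.
Lemma yyE : y ^t theta *m y = u%:M. Proof. exact: mx11_scalar. Qed.
Lemma wwE : w ^t theta *m w = v%:M. Proof. exact: mx11_scalar. Qed.
Lemma xxE : x^T *m map_mx theta x = s%:M.
Proof.
by rewrite -[LHS]trmxK trmx_mul trmxK map_trmx [_ *m x]mx11_scalar tr_scalar_mx.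
Qed.
Lemma zzE : z^T *m map_mx theta z = t%:M.
Proof.
by rewrite -[LHS]trmxK trmx_mul trmxK map_trmx [_ *m z]mx11_scalar tr_scalar_mx.
Qed.

(** * Moore-Penrose inverse of a double star matrix *)

(** The vectors (0,y,0,0) and (0,0,0,w) lie in the column space of [M] and every
    column of [M] is orthogonal to them up to a multiple of u, respectively v;
    so they would be killed by [M]^* if u, respectively v, were zero. *)
Lemma double_star_normsq_neq0 : y != 0 -> w != 0 -> z != 0 -> x != 0 ->
  mp_invertible theta M -> u != 0 /\ v != 0.
Proof.
move=> y0 w0 /left_inverse_col[c zc] /left_inverse_col[d xd] hM; split.
- apply: contraNneq y0 => uE.
  (* M e_p = (0, y, b, 0); the third entry is cancelled by a combination of the
     leaves o, whose images are multiples of e_r. *)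
  set N := col_mx (col_mx 1%:M 0) (col_mx 0 (- b *: c)) : 'cV[F]_(1 + m + (1 + n)).
  have MN : M *m N = col_mx (col_mx 0 y) 0.
    rewrite !mul_blockE !(scalar_mxE, zero_mxE) -!scalemxAr zc
            !(scalar_mxE, zero_mxE) !mulr1.
    by rewrite -raddfD subrr raddf0 col_mx0 scale1r.
  have := @mp_ctrmx_cancel F theta _ _ _ M N hM.
  rewrite MN !ctr_blockE !mul_blockE !zero_mxE yyE uE raddf0 !col_mx0.
  by move=> /(_ erefl)/eqP; rewrite !col_mx_eq0 => /andP[/andP[]].
- apply: contraNneq w0 => vE.
  (* M e_r = (a, 0, 0, w); the first entry is cancelled by a combination of the
     leaves q, whose images are multiples of e_p. *)
  set N := col_mx (col_mx 0 (- a *: d)) (col_mx 1%:M 0) : 'cV[F]_(1 + m + (1 + n)).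
  have MN : M *m N = col_mx 0 (col_mx 0 w).
    rewrite !mul_blockE !(scalar_mxE, zero_mxE) -!scalemxAr xd
            !(scalar_mxE, zero_mxE) !mulr1.
    by rewrite -raddfD addNr raddf0 col_mx0 scale1r.
  have := @mp_ctrmx_cancel F theta _ _ _ M N hM.
  rewrite MN !ctr_blockE !mul_blockE !zero_mxE wwE vE raddf0 !col_mx0.
  by move=> /(_ erefl)/eqP; rewrite !col_mx_eq0 => /andP[_ /andP[]].
Qed.

(** It maps each vector of the orthogonal basis e_p, (0,y,0,0), e_r, (0,0,0,w) of the
    column space to its unique preimage in the image of [M]^*: e_p to conj(x) / s,
    e_r to conj(z) / t, y to e_p - b conj(z) / t and w to
    e_r - a conj(x) / s, where a leaf vector stands for its extension by 0. *)
Definition double_star_mp : 'M[F]_((1 + m) + (1 + n)) :=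
  block_mx (block_mx 0 (u^-1 *: y ^t theta) (s^-1 *: map_mx theta x) 0)
           (block_mx 0 0 0 (- (a / (s * v)) *: (map_mx theta x *m w ^t theta)))
           (block_mx 0 0 0 (- (b / (t * u)) *: (map_mx theta z *m y ^t theta)))
           (block_mx 0 (v^-1 *: w ^t theta) (t^-1 *: map_mx theta z) 0).

Definition row_proj : 'M[F]_((1 + m) + (1 + n)) :=
  block_mx (block_mx 1%:M 0 0 (s^-1 *: (map_mx theta x *m x^T))) 0
           0 (block_mx 1%:M 0 0 (t^-1 *: (map_mx theta z *m z^T))).
Definition col_proj : 'M[F]_((1 + m) + (1 + n)) :=
  block_mx (block_mx 1%:M 0 0 (u^-1 *: (y *m y ^t theta))) 0
           0 (block_mx 1%:M 0 0 (v^-1 *: (w *m w ^t theta))).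

Section MoorePenrose.
Hypotheses (s0 : s != 0) (u0 : u != 0) (t0 : t != 0) (v0 : v != 0).

Lemma mul_double_star_mp : M *m double_star_mp = col_proj.
Proof.
rewrite !mul_blockE !(scalar_mxE, zero_mxE) -!scalemxAr !mulmxA
        xxE zzE !scalar_mxE !scalerA !mulVf //.
have -> : - (a / (s * v)) * s = - (a / v) by field; rewrite v0 s0.
have -> : - (b / (t * u)) * t = - (b / u) by field; rewrite u0 t0.
by rewrite !scaleNr addNr subrr !block_mx0.
Qed.

Lemma mul_mp_double_star : double_star_mp *m M = row_proj.
Proof.
rewrite !mul_blockE !(scalar_mxE, zero_mxE) -!scalemxAl -!mulmxA
        yyE wwE !scalar_mxE !scalerA !mulVf //.
have -> : - (a / (s * v)) * v = - (a / s) by field; rewrite v0 s0.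
have -> : - (b / (t * u)) * u = - (b / t) by field; rewrite u0 t0.
by rewrite !scaleNr subrr addNr !block_mx0.
Qed.

Lemma row_proj_mp : row_proj *m double_star_mp = double_star_mp.
Proof.
rewrite !mul_blockE !(scalar_mxE, zero_mxE, scale1r) -!scalemxAl -!scalemxAr !mulmxA.
rewrite -!(mulmxA _ x^T) -!(mulmxA _ z^T) xxE zzE !scalar_mxE -!scalemxAl !scalerA.
by congr (block_mx (block_mx _ _ (_ *: _) _) (block_mx _ _ _ (_ *: _))
   (block_mx _ _ _ (_ *: _)) (block_mx _ _ (_ *: _) _)); field; rewrite ?s0 ?t0 ?u0 ?v0.
Qed.

Lemma col_proj_double_star : col_proj *m M = M.
Proof.
rewrite !mul_blockE !(scalar_mxE, zero_mxE, scale1r, mul1r) -!scalemxAl -!mulmxA yyE wwE.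
by rewrite !scalar_mxE !scalerA !mulVf // !scale1r.
Qed.

Lemma ctr_row_proj : row_proj ^t theta = row_proj.
Proof.
have xP p (c : 'cV[F]_p) : map_mx theta c *m c^T =
    map_mx theta c *m (map_mx theta c) ^t theta.
  by congr (_ *m _); apply/matrixP => i j; rewrite !mxE rmorphK.
rewrite /row_proj !xP !ctr_blockE !zero_mxE rmorph1 !ctr_outer //.
  by rewrite fmorphV; congr (_^-1); apply: normsq_herm.
by rewrite fmorphV; congr (_^-1); apply: normsq_herm.
Qed.

Lemma ctr_col_proj : col_proj ^t theta = col_proj.
Proof.
rewrite /col_proj !ctr_blockE !zero_mxE rmorph1 !ctr_outer //.
  by rewrite fmorphV; congr (_^-1); apply: normsq_herm.
by rewrite fmorphV; congr (_^-1); apply: normsq_herm.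
Qed.

Lemma double_star_mpP : is_mp_inverse theta M double_star_mp.
Proof.
exact: (mp_inverse_of_projections mul_double_star_mp mul_mp_double_star
  col_proj_double_star row_proj_mp ctr_col_proj ctr_row_proj).
Qed.

End MoorePenrose.

(** * Stable plane of a double star matrix and its MPCEP inverse *)

(** The image of e_p under [M], supported on the neighbours q and r of p. *)
Definition core_f : 'cV[F]_((1 + m) + (1 + n)) :=
  col_mx (col_mx 0 y) (col_mx b%:M 0).
Definition core_g : 'cV[F]_((1 + m) + (1 + n)) :=
  col_mx (col_mx zeta%:M 0) (col_mx 0 (b *: w)).

Lemma core_f_neq0 : b != 0 -> core_f != 0.
Proof. by rewrite !col_mx_eq0 scalar_mx11_eq0 !negb_and orbC => ->. Qed.

Lemma core_g_neq0 : zeta != 0 -> core_g != 0.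
Proof. by rewrite !col_mx_eq0 scalar_mx11_eq0 !negb_and => ->. Qed.

Lemma core_fg : core_f ^t theta *m core_g = 0.
Proof. by rewrite !ctr_blockE !mul_blockE !zero_mxE. Qed.

Lemma core_ff : (core_f ^t theta *m core_f) 0 0 = h.
Proof.
rewrite !ctr_blockE !mul_blockE !(scalar_mxE, zero_mxE) yyE.
by rewrite -raddfD mxE eqxx addrC mulrC.
Qed.

Lemma core_gg : (core_g ^t theta *m core_g) 0 0 = beta.
Proof.
rewrite !ctr_blockE linearZ map_mxZ !mul_blockE !(scalar_mxE, zero_mxE).
rewrite -scalemxAl -scalemxAr wwE !scalar_mxE -raddfD mxE eqxx mulr1n /beta; ring.
Qed.

Lemma double_star_core_f : M *m core_f = core_g.
Proof. by rewrite !mul_blockE !(scalar_mxE, zero_mxE) xyE -raddfD. Qed.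

Hypothesis zw : (z^T *m w) 0 0 = 0.

Lemma zwE : z^T *m w = 0.
Proof. by rewrite [LHS]mx11_scalar zw raddf0. Qed.

Lemma double_star_core_g : M *m core_g = zeta *: core_f.
Proof.
rewrite !mul_blockE !(scalar_mxE, zero_mxE) -scalemxAr zwE !zero_mxE !scale_col_mx.
by rewrite !(scalar_mxE, zero_mxE) mulrC.
Qed.

(** The nilpotent part dies at the third power: with z^T w = 0, [M] kills
    (0,0,0,w), so that M^2 sends e_r to a multiple of f and M^3 sends the leaves
    of r to the same line, while [M] sends e_p to f and the leaves of p to
    multiples of e_p. *)
Lemma double_star_cube :
  M ^+ 3 = core_f *m row_mx (row_mx zeta%:M 0) (row_mx 0 (a *: z^T))
         + core_g *m row_mx (row_mx 0 x^T) (row_mx a%:M 0).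
Proof.
have MM : M *m M =
    block_mx (block_mx zeta%:M 0 0 (y *m x^T)) (block_mx 0 (a *: z^T) (a *: y) 0)
             (block_mx 0 (b *: x^T) (b *: w) 0) (block_mx (a * b)%:M 0 0 (w *m z^T)).
  by rewrite !mul_blockE !(scalar_mxE, zero_mxE) xyE zwE !zero_mxE -raddfD (mulrC b).
rewrite exprS expr2 -!mulmxE MM !mul_blockE !(scalar_mxE, zero_mxE)
        -!scalemxAr -!scalemxAl !mulmxA xyE zwE.
rewrite !(scalar_mxE, zero_mxE) -raddfD !scalerA -scalerDl -mulrDr.
by rewrite (mulrC zeta a).
Qed.

Lemma row_proj_core_f :
  row_proj *m core_f =
  col_mx (col_mx 0 ((s^-1 * xy) *: map_mx theta x)) (col_mx b%:M 0).
Proof.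
by rewrite !mul_blockE !(scalar_mxE, zero_mxE) mul1r -scalemxAl -mulmxA
           xyE !scalar_mxE scalerA.
Qed.

Lemma row_proj_core_g :
  row_proj *m core_g = col_mx (col_mx zeta%:M 0) 0.
Proof.
by rewrite !mul_blockE !(scalar_mxE, zero_mxE) mul1r -scalemxAl -scalemxAr -mulmxA
            zwE !zero_mxE col_mx0.
Qed.

(** Left multiplication by the row space projection keeps e_p and e_r, replaces
    y by its component along conj(x), and kills w because z^T w = 0. *)
Lemma row_proj_cycle_cep : zeta != 0 ->
  row_proj *m cycle_cep theta core_f core_g zeta =
     block_mx
       (block_mx 0 (h^-1 *: y ^t theta)
                 (((s * beta)^-1 * theta zeta * xy) *: map_mx theta x) 0)
       (block_mx (theta b * h^-1)%:M 0
                 0 (((s * beta)^-1 * theta b * xy) *: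
                      (map_mx theta x *m w ^t theta)))
       (block_mx (beta^-1 * theta zeta * b)%:M 0
                 0 0)
       (block_mx 0 ((beta^-1 * b * theta b) *: w ^t theta)
                 0 0).
Proof.
move=> zeta0; rewrite /cycle_cep core_ff core_gg mulmxDr -!scalemxAr !mulmxA.
rewrite row_proj_core_f row_proj_core_g.
rewrite !ctr_blockE linearZ /= map_mxZ !mul_blockE !(scalar_mxE, zero_mxE) !row_mx0.
rewrite !scale_block_mx !mul_blockE !(scalar_mxE, zero_mxE) -scalemxAl -scalemxAr.
rewrite !scalerA mulrA.
have -> : (zeta * h)^-1 * zeta = h^-1 by rewrite invfM mulrAC mulVf ?mul1r.
rewrite !invfM.
by congr (block_mx (block_mx _ _ (_ *: _) _) (block_mx _%:M _ _ (_ *: _))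
   (block_mx _%:M _ _ _) (block_mx _ (_ *: _) _ _)); ring.
Qed.

End DoubleStar.

Theorem lemma5p2 (F : fieldType) (theta : involutive_rmorphism F) (m n : nat)
    (x y : 'cV[F]_m) (z w : 'cV[F]_n) (a b : F) :
  (0 < m)%N -> (0 < n)%N ->
  (forall i, x i 0 != 0) -> (forall i, y i 0 != 0) ->
  (forall i, z i 0 != 0) -> (forall i, w i 0 != 0) ->
  a != 0 -> b != 0 ->
  let M := double_star_mx x y z w a b in
  let xy := (x^T *m y) 0 0 in
  let zeta := xy + a * b in
  let s := (x ^t theta *m x) 0 0 in
  let u := (y ^t theta *m y) 0 0 in
  let t := (z ^t theta *m z) 0 0 in
  let v := (w ^t theta *m w) 0 0 in
  let h := b * theta b + u in
  let beta := zeta * theta zeta + b * theta b * v in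
  xy != 0 -> (z^T *m w) 0 0 = 0 -> zeta != 0 ->
  (mp_invertible theta M /\ cep_invertible theta M <->
     [&& s != 0, u != 0, t != 0, v != 0, h != 0 & beta != 0]) /\
  (mp_invertible theta M -> cep_invertible theta M ->
   forall X : 'M[F]_((1 + m) + (1 + n)),
     is_mpcep_inverse theta M X <->
     X = block_mx
       (block_mx 0 (h^-1 *: y ^t theta)
                 (((s * beta)^-1 * theta zeta * xy) *: map_mx theta x) 0)
       (block_mx (theta b * h^-1)%:M 0
                 0 (((s * beta)^-1 * theta b * xy) *:
                      (map_mx theta x *m w ^t theta)))
       (block_mx (beta^-1 * theta zeta * b)%:M 0
                 0 0)
       (block_mx 0 ((beta^-1 * b * theta b) *: w ^t theta)
                 0 0)).
Proof.
have cV_neq0 p (c : 'cV[F]_p) : (0 < p)%N -> (forall i, c i 0 != 0) -> c != 0.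
  by move=> p0 c0; apply/cV0Pn; exists (Ordinal p0).
move=> m0 n0 /(cV_neq0 _ _ m0) x0 /(cV_neq0 _ _ m0) y0 /(cV_neq0 _ _ n0) z0
  /(cV_neq0 _ _ n0) w0 a0 b0 M xy zeta s u t v h beta xy0 zw zeta0.
have Mf := double_star_core_f x y z w a b.
have Mg := double_star_core_g x y a b zw.
have fg := core_fg theta x y w a b.
have cube := double_star_cube x y a b zw.
have mp_neq0 : mp_invertible theta M -> [/\ s != 0, u != 0, t != 0 & v != 0].
  move=> hM; have [u0 v0] := double_star_normsq_neq0 y0 w0 z0 x0 hM.
  have := mp_invertible_tr hM; rewrite tr_double_star => hMT.
  by have [s0 t0] := double_star_normsq_neq0 x0 z0 w0 y0 hMT.
have cep_neq0 : cep_invertible theta M -> h != 0 /\ beta != 0.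
  move=> hM; have := cep_cycle_neq0 zeta0 Mf Mg fg cube
    (core_f_neq0 n y b0) (core_g_neq0 w zeta0) hM.
  by rewrite core_ff core_gg.
have cepP : h != 0 -> beta != 0 ->
    is_cep_inverse theta M (cycle_cep theta (core_f n y b) (core_g x y w a b) zeta).
  by move=> h0 beta0; apply: (cycle_cepP zeta0 Mf Mg fg cube);
     rewrite ?core_ff ?core_gg.
split; first split.
- by move=> [/mp_neq0[-> -> -> ->] /cep_neq0[-> ->]].
- case/and5P=> s0 u0 t0 v0 /andP[h0 beta0]; split; last by eexists; apply: cepP.
  by eexists; apply: double_star_mpP.
- move=> /mp_neq0[s0 u0 t0 v0] /cep_neq0[h0 beta0] X.
  rewrite (mpcep_inverseE X (double_star_mpP _ _ s0 u0 t0 v0) (cepP h0 beta0)).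
  by rewrite mul_mp_double_star // row_proj_cycle_cep.
Qed.
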